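(* Let $(\mathcal X,\mathcal B)$ be a measurable space, $\mathcal P$ the set of probability measures on it, and $\mathcal D_f$ an $f$-divergence on $\mathcal P$. Let $S\colon \mathcal P\rightharpoonup\mathcal Y$ be a statistic (a partial map with domain $\operatorname{dom}(S)\subseteq\mathcal P$), $\mathbb P\in\operatorname{dom}(S)$ a target distribution, and $\mathcal Q\subseteq\operatorname{dom}(S)$ a variational family. Assume that the problem of minimising $\mathcal D_f(\mathbb P\|\mathbb Q)$ over $\mathbb Q\in\mathcal Q$ has a unique minimiser, denoted $\mathbb Q^\star$. Suppose that for some group $\mathcal G$ of measurable bijections $\mathcal X\to\mathcal X$ with measurable inverses (under composition), the following hold: (1) $\mathbb P$ is $\mathcal G$-invariant; (2) $\mathcal Q$ is $\mathcal G$-stable; (3) $\operatorname{dom}(S)$ is $\mathcal G$-stable, and for all $g\in\mathcal G$ and $\pi_1,\pi_2\in\operatorname{dom}(S)$, $S(\pi_1)=S(\pi_2)$ implies $S(g_\#\pi_1)=S(g_\#\pi_2)$. Then $$S(\mathbb P)\in\Gamma_S(\mathcal G)\quad\text{and}\quad S(\mathbb Q^\star)\in\Gamma_S(\mathcal G).$$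
   Context: **$f$-divergence.** Let $f\colon\mathbb R_{>0}\to\mathbb R$ be convex with $f(1)=0$, extended by $f(0):=\lim_{t\downarrow0}f(t)$ and $f'(\infty):=\lim_{t\downarrow0}t f(1/t)$ (both possibly $+\infty$). For $\mathbb P,\mathbb Q\in\mathcal P$ and any $\sigma$-finite measure $\mu$ with $\mathbb P,\mathbb Q\ll\mu$, with densities $p=d\mathbb P/d\mu$, $q=d\mathbb Q/d\mu$, $$\mathcal D_f(\mathbb P\|\mathbb Q):=\int_{\{q>0\}}q\,f(p/q)\,d\mu+f'(\infty)\,\mathbb P(\{q=0\})\in[0,\infty],\qquad 0\cdot\infty:=0.$$ **Pushforward, invariance, stability.** For a measurable bijection $g$ with measurable inverse and $\pi\in\mathcal P$, $g_\#\pi(A):=\pi(g^{-1}(A))$ for $A\in\mathcal B$. A measure $\pi\in\mathcal P$ is $\mathcal G$-invariant if $g_\#\pi=\pi$ for all $g\in\mathcal G$. A collection $\mathcal F\subseteq\mathcal P$ is $\mathcal G$-stable if $g_\#\pi\in\mathcal F$ for all $g\in\mathcal G$, $\pi\in\mathcal F$. **Fixed set.** Under (3), for each $g\in\mathcal G$ the map $\rho_g\colon\operatorname{Im}(S)\to\operatorname{Im}(S)$, $\rho_g(y):=S(g_\#\pi)$ for any $\pi\in\operatorname{dom}(S)$ with $S(\pi)=y$, is well defined, where $\operatorname{Im}(S)=\{S(\pi)\mid\pi\in\operatorname{dom}(S)\}$. Define $$\Gamma_S(\mathcal G):=\{y\in\operatorname{Im}(S)\mid\rho_g(y)=y\ \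 \forall g\in\mathcal G\}.$$ *)

(* Defs.v *)
From HB Require Import structures.
From mathcomp Require Import all_boot all_order all_algebra.
From mathcomp Require Import all_classical all_reals all_analysis.
From mathcomp Require Import measurable_realfun giry ring.

Set Implicit Arguments.
Unset Strict Implicit.
Unset Printing Implicit Defensive.

Import Order.TTheory GRing.Theory Num.Theory.
Import numFieldNormedType.Exports.

Local Open Scope classical_set_scope.
Local Open Scope ring_scope.
Local Open Scope ereal_scope.

Section sum_of_probabilities.
Context d (X : measurableType d) (R : realType) (P Q : probability X R).

Definition prob_sum : set X -> \bar R := measure_add P Q.

HB.instance Definition _ := Measure.on prob_sum.

Local Lemma prob_sum_fin : fin_num_fun prob_sum.
Proof.
by move=> A mA; rewrite /prob_sum measure_addE fin_numD !fin_num_measure.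
Qed.

HB.instance Definition _ := Measure_isFinite.Build _ _ _ prob_sum prob_sum_fin.

Lemma prob_sumE A : prob_sum A = P A + Q A.
Proof. exact: measure_addE. Qed.

Lemma dominates_prob_suml : P `<< prob_sum.
Proof.
apply/null_content_dominatesP => A mA PQA; apply/eqP.
have /eqP := prob_sumE A; rewrite [prob_sum A]PQA eq_sym padde_eq0//.
by move=> /andP[].
Qed.

Lemma dominates_prob_sumr : Q `<< prob_sum.
Proof.
apply/null_content_dominatesP => A mA PQA; apply/eqP.
have /eqP := prob_sumE A; rewrite [prob_sum A]PQA eq_sym padde_eq0//.
by move=> /andP[].
Qed.

End sum_of_probabilities.

Section f_divergence.
Context d (X : measurableType d) (R : realType).

(* f stands for a function on the positive reals: its values on (-oo, 0] are
   never used below. *)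
Definition fdiv_generator (f : R -> R) : Prop :=
  convex_function (E := R^o) [set x | (0 < x)%R] f /\ f 1%R = 0%R.

(* f(0) and f'(+oo); both are limits in \bar R and may be +oo. *)
Definition gen_at0 (f : R -> R) : \bar R := lim ((f t)%:E @[t --> 0^'+]).

Definition gen_slope (f : R -> R) : \bar R :=
  lim ((t * f (t^-1))%:E @[t --> 0^'+]).

Definition gen_ext (f : R -> R) (t : R) : \bar R :=
  if (0 < t)%R then (f t)%:E else gen_at0 f.

(* Any nonnegative density p of P; its existence entails P `<< mu. *)
Definition is_density (mu : set X -> \bar R) (P : probability X R)
    (p : X -> R) : Prop :=
  [/\ measurable_fun [set: X] p, forall x, (0 <= p x)%R &
      forall A, measurable A -> P A = \int[mu]_(x in A) (p x)%:E].

(* In \bar R, 0 * +oo = 0. *)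
Definition fdiv_wrt (mu : set X -> \bar R) (f : R -> R) (P : probability X R)
    (p q : X -> R) : \bar R :=
  \int[mu]_(x in [set x | (0 < q x)%R]) ((q x)%:E * gen_ext f (p x / q x))
  + gen_slope f * P [set x | q x = 0%R].

Definition prob_density (P : probability X R)
    (mu : {sigma_finite_measure set X -> \bar R}) (x : X) : R :=
  fine (Radon_Nikodym_SigmaFinite.f P mu x).

(* The dominating measure P + Q is a choice without consequence: fdivE below
   gives the same value for every sigma-finite mu and all densities p, q. *)
Definition fdiv (f : R -> R) (P Q : probability X R) : \bar R :=
  fdiv_wrt (prob_sum P Q) f P
    (prob_density P (prob_sum P Q)) (prob_density Q (prob_sum P Q)).

End f_divergence.

Section f_divergence_dominating_measure.
Context d (X : measurableType d) (R : realType).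

Local Notation RN := Radon_Nikodym_SigmaFinite.f.

Lemma prob_densityP (P : probability X R)
    (mu : {sigma_finite_measure set X -> \bar R}) :
  P `<< mu -> is_density mu P (prob_density P mu).
Proof.
move=> Pmu; split.
- have mf := measurable_int _ (Radon_Nikodym_SigmaFinite.f_integrable Pmu).
  exact: (measurableT_comp (fine_measurable measurableT) mf).
- by move=> x; apply/fine_ge0/Radon_Nikodym_SigmaFinite.f_ge0.
- move=> A mA; rewrite (Radon_Nikodym_SigmaFinite.f_integral Pmu mA).
  apply: eq_integral => x _; rewrite fineK//.
  exact: Radon_Nikodym_SigmaFinite.f_fin_num.
Qed.

Local Lemma change_of_variables (nu : {finite_measure set X -> \bar R})
    (mu : {sigma_finite_measure set X -> \bar R}) (g : X -> \bar R) :
  nu `<< mu -> measurable_fun [set: X] g ->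
  \int[mu]_x (g x * RN nu mu x) = \int[nu]_x g x.
Proof.
move=> numu mg.
have h0 := Radon_Nikodym_SigmaFinite.f_ge0 numu.
rewrite integralE [RHS]integralE; congr (_ - _).
- rewrite -(Radon_Nikodym_SigmaFinite.change_of_variables numu)//; last first.
    exact: measurable_funepos.
  apply: eq_integral => x _; rewrite !funeposE.
  have [gx|gx] := leP 0 (g x).
    by rewrite max_l// mule_ge0.
  by rewrite mul0e max_r// mule_le0_ge0// ltW.
- rewrite -(Radon_Nikodym_SigmaFinite.change_of_variables numu)//; last first.
    exact: measurable_funeneg.
  apply: eq_integral => x _; rewrite !funenegE -mulNe.
  have [gx|gx] := leP 0 (- g x).
    by rewrite max_l// mule_ge0.
  by rewrite mul0e max_r// mule_le0_ge0// ltW.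
Qed.

Local Lemma measurable_gen_ext f : fdiv_generator f ->
  measurable_fun [set: R] (gen_ext f).
Proof.
move=> [cf _].
have mpos : measurable [set x : R | (0 < x)%R].
  by rewrite -[X in measurable X]set_itvE; exact: measurable_itv.
apply: measurable_fun_if => //.
  apply: (measurable_fun_bool true); rewrite setTI.
  rewrite [X in measurable X](_ : _ = [set x : R | (0 < x)%R])//.
rewrite setTI [X in measurable_fun X](_ : _ = [set x : R | (0 < x)%R])//.
apply/measurable_EFinP.
move=> _; apply: (measurability _ (RGenCInfty.measurableE R)) => //.
move=> /= _ [_ [r ->] <-].
rewrite (_ : _ `&` _ =
    [set x | (0 < x)%R] `\` [set x | (0 < x)%R /\ (f x < r)%R]); last first.
  apply/seteqP; split=> x /=; rewrite in_itv/= andbT.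
    by move=> [x0 rx]; split=> // -[_]; rewrite ltNge rx.
  by move=> [x0 nfx]; split=> //; rewrite leNgt; apply/negP => fx; exact: nfx.
apply: measurableD => //; apply: is_interval_measurable.
move=> x y [x0 fxr] [y0 fyr] z /andP[xz zy] /=.
split; first exact: lt_le_trans xz.
have [xy|xy] := eqVneq x y.
  by have -> : z = x by apply/eqP; rewrite eq_le xz xy zy.
have {}xy : (x < y)%R by rewrite lt_neqAle xy (le_trans xz).
have yx0 : (0 < y - x)%R by rewrite subr_gt0.
pose t := ((y - z) / (y - x))%R.
have t0 : (0 <= t)%R by rewrite divr_ge0// ?subr_ge0// ltW.
have t1 : (t <= 1)%R by rewrite ler_pdivrMr// mul1r lerB.
pose s := Itv01 t0 t1.
have := cf s x y; rewrite !inE/= => /(_ x0 y0).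
have -> : conv s (x : convex_lmodType R^o) y = z.
  rewrite /conv/= /t /GRing.scale/= /unstable.onem.
  by field; rewrite gt_eqF.
move=> /le_lt_trans; apply; rewrite /conv/= /GRing.scale/= /unstable.onem.
have mr : (Num.max (f x) (f y) < r)%R by rewrite gt_max fxr fyr.
apply: le_lt_trans mr; set m := Num.max _ _.
have xm : (t * f x <= t * m)%R by rewrite ler_wpM2l// le_max lexx.
have ym : ((1 - t) * f y <= (1 - t) * m)%R.
  by rewrite ler_wpM2l ?subr_ge0// le_max lexx orbT.
by apply: le_trans (lerD xm ym) _; rewrite -mulrDl addrC subrK mul1r.
Qed.

Local Lemma measurable_inv : measurable_fun [set: R] (@GRing.inv R).
Proof.
rewrite (_ : GRing.inv = fun x : R => if x == 0%R then 0%R else x^-1%R).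
  apply: measurable_fun_if => //.
    apply: (measurable_fun_bool true); rewrite setTI.
    rewrite [X in measurable X](_ : _ = [set 0%R])//.
    by apply/seteqP; split=> [x /eqP//|x /= ->]; rewrite eqxx.
  rewrite setTI; apply: open_continuous_measurable_fun.
    rewrite (_ : _ @^-1` _ = ~` [set 0%R]); last first.
      by apply/seteqP; split=> [x /negbT/eqP//|x /eqP/negbTE].
    exact/closed_openC/closed_eq.
  by move=> x; rewrite inE/= => /negbT x0; exact: inv_continuous.
by apply/funext => x; case: eqP => // ->; rewrite invr0.
Qed.

Local Lemma prob_sum_dominated (P Q : probability X R)
    (mu : {measure set X -> \bar R}) (p q : X -> R) :
  is_density mu P p -> is_density mu Q q -> prob_sum P Q `<< mu.
Proof.
move=> [mp _ Pp] [mq _ Qq]; apply/null_content_dominatesP => A mA muA.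
rewrite [LHS]prob_sumE Pp// Qq// !null_set_integral ?adde0//;
  by apply/measurable_EFinP; exact: measurable_funTS.
Qed.

Local Lemma ae_eq_density (P : probability X R) (nu : {finite_measure set X -> \bar R})
    (mu : {sigma_finite_measure set X -> \bar R}) (p : X -> R) :
  P `<< nu -> nu `<< mu -> is_density mu P p ->
  ae_eq mu [set: X] (EFin \o p)
    (fun x => (prob_density P nu x)%:E * RN nu mu x).
Proof.
move=> Pnu numu [mp p0 Pp].
have [mp' p'0 Pp'] := prob_densityP Pnu.
have mh := measurable_int _ (Radon_Nikodym_SigmaFinite.f_integrable numu).
apply: integral_ae_eq => //.
- apply/integrableP; split; first exact/measurable_EFinP.
  under eq_integral do rewrite gee0_abs ?lee_fin//.
  by rewrite -Pp// probability_setT ltry.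
- by apply: emeasurable_funM => //; exact/measurable_EFinP.
- move=> A _ mA; rewrite -Pp// Pp'//.
  rewrite Radon_Nikodym_SigmaFinite.change_of_variables//.
  by apply/measurable_EFinP; exact: measurable_funTS.
Qed.

Lemma fdivE f (P Q : probability X R)
    (mu : {sigma_finite_measure set X -> \bar R}) (p q : X -> R) :
  fdiv_generator f -> is_density mu P p -> is_density mu Q q ->
  fdiv f P Q = fdiv_wrt mu f P p q.
Proof.
move=> genf dp dq; have [mp p0 Pp] := dp; have [mq q0 Qq] := dq.
have mumu := prob_sum_dominated dp dq.
have dp' := prob_densityP (@dominates_prob_suml _ _ _ P Q).
have dq' := prob_densityP (@dominates_prob_sumr _ _ _ P Q).
have pE := ae_eq_density (@dominates_prob_suml _ _ _ P Q) mumu dp.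
have qE := ae_eq_density (@dominates_prob_sumr _ _ _ P Q) mumu dq.
rewrite /fdiv; move: dp' dq' pE qE.
move: (prob_density P _) (prob_density Q _) => p' q'.
move=> [mp' p'0 Pp'] [mq' q'0 Qq'] pE qE.
have h0 := Radon_Nikodym_SigmaFinite.f_ge0 mumu.
have hfin := Radon_Nikodym_SigmaFinite.f_fin_num mumu.
have mh := measurable_int _ (Radon_Nikodym_SigmaFinite.f_integrable mumu).
set h := RN _ mu in h0 hfin mh pE qE.
have mpos (r : X -> R) :
    measurable_fun [set: X] r -> measurable [set x | (0 < r x)%R].
  move=> mr; rewrite -[X in measurable X]setTI.
  rewrite [X in _ `&` X](_ : _ = r @^-1` `]0%R, +oo[).
    by apply: mr => //; exact: measurable_itv.
  by apply/seteqP; split=> x /=; rewrite in_itv/= andbT.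
have mzero (r : X -> R) :
    measurable_fun [set: X] r -> measurable [set x | r x = 0%R].
  move=> mr; rewrite -[X in measurable X]setTI.
  exact: (mr measurableT [set 0%R] (measurable_set1 _)).
have mphi (r s : X -> R) : measurable_fun [set: X] r -> measurable_fun [set: X] s ->
    measurable_fun [set: X] (fun x => (s x)%:E * gen_ext f (r x / s x)).
  move=> mr ms; apply: emeasurable_funM; first exact/measurable_EFinP.
  apply: measurableT_comp; first exact: measurable_gen_ext.
  by apply: measurable_funM => //; exact: measurableT_comp measurable_inv ms.
have mrestr (r s : X -> R) : measurable_fun [set: X] r -> measurable_fun [set: X] s ->
    measurable_fun [set: X] ((fun x => (s x)%:E * gen_ext f (r x / s x)) \_
      [set x | (0 < s x)%R]).
  move=> mr ms; apply/(measurable_restrictT _ (mpos _ ms)) => //.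
  by apply: measurable_funTS; exact: mphi.
rewrite /fdiv_wrt; congr (_ + _ * _).
- rewrite integral_mkcond -(change_of_variables mumu); last exact: mrestr.
  rewrite [RHS]integral_mkcond; apply: ae_eq_integral => //.
  + by apply: emeasurable_funM => //; exact: mrestr.
  + exact: mrestr.
  move: pE qE; apply: filterS2 => x /(_ I)/= pxE /(_ I)/= qxE _.
  have a0 : (0 <= fine (h x))%R by rewrite fine_ge0.
  move: pxE qxE; rewrite -/(h x) -(fineK (hfin x)) -!EFinM.
  move: (fine (h x)) a0 => a a0 [pxE] [qxE].
  rewrite !patchE.
  have -> : (x \in [set x | (0 < q x)%R]) = (0 < q x)%R.
    by apply/idP/idP; rewrite inE.
  have -> : (x \in [set x | (0 < q' x)%R]) = (0 < q' x)%R.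
    by apply/idP/idP; rewrite inE.
  rewrite pxE qxE.
  have [->|an0] := eqVneq a 0%R; first by rewrite mule0 mulr0 ltxx.
  have agt0 : (0 < a)%R by rewrite lt_neqAle eq_sym an0.
  rewrite pmulr_lgt0//; case: ifPn => q'x0; last by rewrite mul0e.
  rewrite -mulf_div divff// mulr1 muleAC -EFinM //.
- rewrite Pp ?Pp; [|exact: mzero..].
  rewrite [LHS]integral_mkcond [RHS]integral_mkcond; apply: ae_eq_integral => //.
  + apply/(measurable_restrictT _ (mzero _ mq')) => //.
    by apply/measurable_EFinP; exact: measurable_funTS.
  + apply/(measurable_restrictT _ (mzero _ mq)) => //.
    by apply/measurable_EFinP; exact: measurable_funTS.
  move: pE qE; apply: filterS2 => x /(_ I)/= pxE /(_ I)/= qxE _.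
  move: pxE qxE; rewrite -/(h x) -(fineK (hfin x)) -!EFinM.
  move: (fine (h x)) => a [pxE] [qxE].
  rewrite !patchE.
  have -> : (x \in [set x | q x = 0%R]) = (q x == 0%R).
    by apply/idP/eqP; rewrite inE.
  have -> : (x \in [set x | q' x = 0%R]) = (q' x == 0%R).
    by apply/idP/eqP; rewrite inE.
  rewrite pxE qxE mulf_eq0.
  have [->|an0] := eqVneq a 0%R; first by rewrite mulr0 orbT; case: ifP.
  by rewrite orbF.
Qed.

End f_divergence_dominating_measure.

Section invariance.
Context d (X : measurableType d) (R : realType).

Local Lemma idfun_measurable : measurable_fun [set: X] (@idfun X).
Proof. exact: measurable_id. Qed.

HB.instance Definition _ :=
  isMeasurableFun.Build _ _ X X (@idfun X) idfun_measurable.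

(* Closure under inverses, taken in {mfun X >-> X}, makes every element a
   bijection with measurable inverse. *)
Definition bimeasurable_group (G : set {mfun X >-> X}) : Prop :=
  [/\ G (@idfun X),
      forall g h : {mfun X >-> X}, G g -> G h -> G (g \o h) &
      forall g, G g -> exists2 h, G h & cancel g h /\ cancel h g].

Definition push (g : {mfun X >-> X}) (pi : probability X R) : probability X R :=
  distribution pi g.

(* A library measure is a function on all subsets of X, so two of them are the
   same measure on the sigma-algebra when they are related by measure_eq, which
   is the equality of probability measures used throughout. *)
Definition invariant_under (G : set {mfun X >-> X}) (pi : probability X R) :=
  forall g, G g -> measure_eq (push g pi) pi.

Definition stable_under (G : set {mfun X >-> X}) (F : set (probability X R)) :=
  forall g pi, G g -> F pi -> F (push g pi).

Definition is_minimiser (J : probability X R -> \bar R)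
    (F : set (probability X R)) (pi : probability X R) :=
  F pi /\ forall pi', F pi' -> J pi <= J pi'.

Definition is_unique_minimiser (J : probability X R -> \bar R)
    (F : set (probability X R)) (pi : probability X R) :=
  is_minimiser J F pi /\
  forall pi', is_minimiser J F pi' -> measure_eq pi' pi.

End invariance.

Section statistics.
Context d (X : measurableType d) (R : realType) (Y : Type).

(* A partial map from probability measures to Y. The values of stat outside
   stat_dom are irrelevant; stat_measure_eq says that stat depends only on the
   measure, not on its values on non-measurable sets. *)
Record statistic := Statistic {
  stat_dom : set (probability X R) ;
  stat :> probability X R -> Y ;
  stat_measure_eq : forall pi1 pi2, stat_dom pi1 -> stat_dom pi2 ->
    measure_eq pi1 pi2 -> stat pi1 = stat pi2 }.

Implicit Types (S : statistic) (g : {mfun X >-> X}).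

Definition stat_image S : set Y := S @` stat_dom S.

Definition equivariant S (G : set {mfun X >-> X}) : Prop :=
  forall g, G g -> forall pi1 pi2, stat_dom S pi1 -> stat_dom S pi2 ->
    S pi1 = S pi2 -> S (push g pi1) = S (push g pi2).

(* S (push g pi) for some pi in stat_dom S with S pi = y. By rhoE the choice of
   pi is immaterial; the last branch is only reached outside the image of S. *)
Definition rho S g (y : Y) : Y :=
  if pselect (exists pi, stat_dom S pi /\ S pi = y) is left ex_pi
  then S (push g (sval (cid ex_pi))) else y.

Definition fixed_set S (G : set {mfun X >-> X}) : set Y :=
  [set y | stat_image S y /\ forall g, G g -> rho S g y = y].

Lemma rhoE S G g pi : equivariant S G -> G g -> stat_dom S pi ->
  rho S g (S pi) = S (push g pi).
Proof.
move=> SG Gg Spi; rewrite /rho; case: pselect => [ex|[]]; last by exists pi.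
by case: cid => /= pi' [Spi' pi'pi]; exact: SG.
Qed.

Lemma rho_Im S G g y : stable_under G (stat_dom S) -> equivariant S G -> G g ->
  stat_image S y -> stat_image S (rho S g y).
Proof.
move=> domG SG Gg [pi Spi <-]; rewrite (rhoE SG)//.
by exists (push g pi) => //; exact: domG.
Qed.

End statistics.

(* Main.v *)
Require Import Defs.
From HB Require Import structures.
From mathcomp Require Import all_boot all_order all_algebra.
From mathcomp Require Import all_classical all_reals all_analysis.
From mathcomp Require Import measurable_realfun giry.

(* An f-divergence does not depend on the dominating measure or the densities,
   hence is unchanged when a measurable bijection with measurable inverse is
   applied to both arguments. As P is invariant, g_# Qstar is therefore as close
   to P as Qstar is, so uniqueness forces g_# Qstar = Qstar. *)

Local Open Scope classical_set_scope.

Section divergence.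
Local Set Implicit Arguments.
Local Unset Strict Implicit.
Local Open Scope ring_scope.

(** The integral is the difference of those of the positive and negative parts, so the nonnegative
    case suffices, without integrability. Stating the relation between [nu] and [mu] on measurable
    sets lets [nu] be a sum of two pushforwards. *)
Lemma integral_pushforward_mfun (R : realType) d1 d2 (X : measurableType d1)
    (Y : measurableType d2) (g : {mfun X >-> Y})
    (mu : {measure set X -> \bar R}) (nu : {measure set Y -> \bar R})
    (D : set Y) (F : Y -> \bar R) :
  (forall A, measurable A -> nu A = mu (g @^-1` A)) ->
  measurable D -> measurable_fun D F ->
  (\int[nu]_(y in D) F y = \int[mu]_(x in g @^-1` D) F (g x))%E.
Proof.
move=> nuE mD mF.
have mg : measurable_fun [set: X] g by exact: measurable_funP.
have ge0 (H : Y -> \bar R) : measurable_fun D H -> (forall y, (0 <= H y)%E) ->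
    (\int[nu]_(y in D) H y = \int[mu]_(x in g @^-1` D) H (g x))%E.
  move=> mH H0; rewrite -[RHS](ge0_integral_pushforward mg)//.
  by apply: eq_measure_integral => A mA _; exact: nuE.
rewrite integralE [RHS]integralE; congr (_ - _)%E.
- rewrite (ge0 (F^\+)%E)//; last exact: measurable_funepos.
  by apply: eq_integral => x _; rewrite !funeposE.
- rewrite (ge0 (F^\-)%E)//; last exact: measurable_funeneg.
  by apply: eq_integral => x _; rewrite !funenegE.
Qed.

(** Densities are tested on measurable sets only, so a density of [P'] is also one of [P], and
    [fdivE] applies with the dominating measure of the right-hand side. *)
Lemma fdiv_measure_eql (R : realType) d (X : measurableType d) (f : R -> R)
    (P P' Q : probability X R) :
  fdiv_generator f -> measure_eq P P' -> fdiv f P Q = fdiv f P' Q.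
Proof.
move=> gf PP'.
have [mp p0 P'p] := prob_densityP (@dominates_prob_suml _ _ _ P' Q).
have dq := prob_densityP (@dominates_prob_sumr _ _ _ P' Q).
rewrite (fdivE (p := prob_density P' (prob_sum P' Q)) gf _ dq); last first.
  split=> [|x|A mA]; [exact: mp|exact: p0|].
  exact: (etrans (PP' A mA) (P'p A mA)).
(* The two sides now differ only in the mass of the measurable set where the density of [Q]
   vanishes. *)
rewrite /fdiv /fdiv_wrt PP'//; have [mq _ _] := dq.
by rewrite -[X in measurable X]setTI; exact: (mq measurableT [set 0%R]).
Qed.

Section pushforward_divergence.
Context (R : realType) d (X : measurableType d).
Context (g h : {mfun X >-> X}) (gh : cancel g h).

Lemma is_density_comp (mu nu : {measure set X -> \bar R})
    (P : probability X R) (p : X -> R) :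
  (forall A, measurable A -> nu A = mu (g @^-1` A)) ->
  is_density nu (push g P) p -> is_density mu P (p \o g).
Proof.
move=> nuE [mp p0 Pp]; split => [|x|A mA] /=.
- exact: measurableT_comp.
- exact: p0.
have ghA : g @^-1` (h @^-1` A) = A.
  by apply/seteqP; split => x /=; rewrite gh.
have mhA : measurable (h @^-1` A).
  by rewrite -[X in measurable X]setTI; exact: measurable_funP.
rewrite -{1}ghA -[LHS]/(push g P (h @^-1` A)) Pp//.
rewrite (integral_pushforward_mfun nuE)// ?ghA//.
by apply/measurable_EFinP; exact: measurable_funTS.
Qed.

Lemma fdiv_push (f : R -> R) (P Q : probability X R) :
  fdiv_generator f -> fdiv f (push g P) (push g Q) = fdiv f P Q.
Proof.
move=> gf; set nu := prob_sum (push g P) (push g Q).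
have nuE A : measurable A -> nu A = prob_sum P Q (g @^-1` A).
  by move=> _; rewrite /nu !prob_sumE.
have dp := prob_densityP (@dominates_prob_suml _ _ _ (push g P) (push g Q)).
have dq := prob_densityP (@dominates_prob_sumr _ _ _ (push g P) (push g Q)).
rewrite (fdivE (mu := prob_sum P Q) gf (is_density_comp nuE dp)
  (is_density_comp nuE dq)).
rewrite /fdiv -/nu; move: dp dq => [+ _ _] [+ _ _]; rewrite -/nu.
move: (prob_density _ _) (prob_density _ _) => q p mp mq.
(* The singular terms agree by definition of [push]; the integrals agree by change of variables. *)
rewrite /fdiv_wrt; congr (_ + _)%E.
rewrite (integral_pushforward_mfun nuE)//.
  rewrite -[X in measurable X]setTI.
  rewrite [X in _ `&` X](_ : _ = q @^-1` `]0%R, +oo[).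
    by apply: mq => //; exact: measurable_itv.
  by apply/seteqP; split=> x /=; rewrite in_itv/= andbT.
apply: measurable_funTS; apply: emeasurable_funM; first exact/measurable_EFinP.
apply: measurableT_comp; first exact: Defs.measurable_gen_ext.
apply: measurable_funM => //.
exact: (measurableT_comp (@Defs.measurable_inv _) mq).
Qed.

End pushforward_divergence.

End divergence.

Theorem theorem3p1 (R : realType) (d : measure_display) (X : measurableType d)
    (Y : Type) (f : R -> R) (S : statistic X R Y) (P : probability X R)
    (Q : set (probability X R)) (Qstar : probability X R)
    (G : set {mfun X >-> X})
    (f_gen : fdiv_generator f)
    (P_dom : stat_dom S P)
    (Q_dom : Q `<=` stat_dom S)
    (Qstar_min : is_unique_minimiser (fdiv f P) Q Qstar)
    (G_group : bimeasurable_group G)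
    (P_inv : invariant_under G P)
    (Q_stable : stable_under G Q)
    (dom_stable : stable_under G (stat_dom S))
    (S_compat : equivariant S G) :
  fixed_set S G (S P) /\ fixed_set S G (S Qstar).
Proof.
(* An invariant [pi] serves as its own representative in [rho], so both conclusions reduce to
   invariance. *)
have fixed pi : stat_dom S pi -> invariant_under G pi -> fixed_set S G (S pi).
  move=> Spi pi_inv; split; first by exists pi.
  move=> g Gg; rewrite (rhoE S_compat Gg Spi).
  by apply: stat_measure_eq; [exact: dom_stable|exact: Spi|exact: pi_inv].
have [[QQstar Qstar_le] Qstar_uniq] := Qstar_min.
split; first exact: fixed.
apply: fixed => [|g Gg]; first exact: Q_dom.
apply: Qstar_uniq; split=> [|pi Qpi]; first exact: Q_stable.
have [_ _ /(_ g Gg)[h _ [gh _]]] := G_group.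
(* Invariance replaces [P] by [push g P], so that [g] acts on both arguments and can be removed. *)
rewrite -(fdiv_measure_eql (push g Qstar) f_gen (P_inv g Gg)) (fdiv_push gh)//.
exact: Qstar_le.
Qed.
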